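(* Let $\alpha = (\alpha_1,\dots,\alpha_n)$ be a graphic degree sequence with $\alpha_n \ge 1$. If $\mathcal{F}(\alpha) \neq \emptyset$ or $\mathcal{B}(\alpha) \neq \emptyset$, then every realization $G$ of $\alpha$ satisfies $\operatorname{diam}(G) \le 3$.
   Context: All graphs are simple and undirected. A degree sequence of length $n$ is an integer sequence $\alpha=(\alpha_1,\dots,\alpha_n)$ with $n-1 \ge \alpha_1 \ge \cdots \ge \alpha_n \ge 0$. A (labeled) realization of $\alpha$ is a simple graph on the labeled vertex set $\{v_1,\dots,v_n\}$ in which $v_i$ has degree $\alpha_i$ for every $i$; $\alpha$ is graphic if it has at least one realization. The forced set $\mathcal{F}(\alpha)$ is the set of all edges $v_iv_j$ (between labeled vertices, $i \ne j$) that appear in every realization of $\alpha$; the forbidden set $\mathcal{B}(\alpha)$ is the set of all edges $v_iv_j$ ($i \ne j$) that appear in no realization of $\alpha$. $\operatorname{diam}(G)$ is the diameter of $G$, the maximum distance between two vertices (so $\operatorname{diam}(G)\le 3$ means that any two vertices are joined by a path of length at most 3; in particular $G$ is connected). *)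

(* Defs.v *)
From mathcomp Require Import all_boot.

Set Implicit Arguments.
Unset Strict Implicit.
Unset Printing Implicit Defensive.

(* A simple graph on T is given by its edge set: a set of
   two-element subsets of T, so loops and multiple edges are excluded. *)
Section Graphs.
Variable T : finType.
Implicit Types (G : {set {set T}}) (x y : T).

Definition simple_graph G : bool := [forall e in G, #|e| == 2].

Definition adj G : rel T := fun x y => [set x; y] \in G.

Definition degree G x : nat := #|[set y | adj G x y]|.

Definition joined_by_path G x y (k : nat) : bool :=
  [exists p : k.-tuple T,
     [&& path (adj G) x p, uniq (x :: p) & last x p == y]].

(* Paths have pairwise distinct vertices, hence length less than #|T|: when
   the search below fails (find then returns #|T|), x and y lie in different
   components, and their distance is infinite, encoded as None. *)
Definition dist G x y : option nat :=
  let d := find (joined_by_path G x y) (iota 0 #|T|) in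
  if d < #|T| then Some d else None.

(* None encodes an infinite diameter (disconnected graph); when every distance
   is finite, the default 0 of odflt is never used. *)
Definition diam G : option nat :=
  if [forall x, forall y, dist G x y != None]
  then Some (\max_x \max_y odflt 0 (dist G x y))
  else None.

End Graphs.

(* The entries alpha_1, ..., alpha_n and the vertices v_1, ..., v_n are indexed
   from 0, by 'I_n.  The defaults of head and last only matter for n = 0. *)
Section DegreeSequences.
Variable n : nat.
Implicit Type alpha : n.-tuple nat.

Definition degree_sequence alpha : bool :=
  (head 0 alpha <= n.-1) && sorted geq alpha.

Definition realization alpha (G : {set {set 'I_n}}) : bool :=
  simple_graph G && [forall i, degree G i == tnth alpha i].

Definition graphic alpha : Prop := exists G, realization alpha G.

Definition forced alpha : {set {set 'I_n}} :=
  [set e : {set 'I_n} | (#|e| == 2) &&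
     [forall G, realization alpha G ==> (e \in G)]].

Definition forbidden alpha : {set {set 'I_n}} :=
  [set e : {set 'I_n} | (#|e| == 2) &&
     [forall G, realization alpha G ==> (e \notin G)]].

End DegreeSequences.

(* Main.v *)
Require Import Defs.
From mathcomp Require Import all_boot.

(** Suppose that a realization [G] has vertices [u], [w] at distance at least 4.
    Then the closed neighbourhoods of [u] and [w] are disjoint with no edge
    between them, so an edge at [u] and an edge at [w] can always be switched.
    Combining such switches with an arbitrary edge [xy] yields a realization
    without [xy], so no edge is forced; keeping track of the edges at [x] and
    [y] during this removal allows one more switch that inserts any prescribed
    non-edge, so no edge is forbidden. *)

Set Implicit Arguments.
Unset Strict Implicit.
Unset Printing Implicit Defensive.

Section Switch.
Variable T : finType.
Implicit Types (G : {set {set T}}) (x y a b c d u v w : T).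

(** * Edges as two-element sets, and degrees *)

Lemma eq_set2 x y a b :
  ([set x; y] == [set a; b]) = (x == a) && (y == b) || (x == b) && (y == a).
Proof.
apply/eqP/idP => [E | /orP[] /andP[/eqP-> /eqP->] //]; last by rewrite setUC.
have := set21 x y; have := set22 x y; rewrite E !inE.
have := set22 a b; have := set21 a b; rewrite -E !inE !(eq_sym _ x) !(eq_sym _ y).
by do 4 case: (_ == _).
Qed.

Lemma adjC G x y : adj G x y = adj G y x.
Proof. by rewrite /adj setUC. Qed.

Lemma adj_neq G x y : simple_graph G -> adj G x y -> x != y.
Proof. by move=> /forall_inP sG /sG; rewrite cards2; case: (x != y). Qed.

(** Counting incident edges instead of neighbours turns a degree into a sum over the edge set, in
    which a switch alters only four terms. *)
Lemma degree_incident G v : simple_graph G ->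
  degree G v = \sum_(e in G) (v \in e).
Proof.
move=> sG; rewrite /degree -sum1_card -big_mkcondr /=.
have inj_pair : {in [set y | adj G v y] &, injective (fun y => [set v; y])}.
  move=> y z _ _ /eqP; rewrite eq_set2 eqxx /=.
  by case/orP => [/eqP // | /andP[/eqP-> /eqP->]].
rewrite -(big_imset (fun=> 1) inj_pair); apply: eq_bigl => e.
apply/imsetP/andP => [[y] | [eG ve]]; first by rewrite inE => Gvy ->; rewrite set21.
have /cards2P[x [y [_ De]]] := forall_inP sG e eG.
move: eG ve; rewrite De !inE => eG /orP[]/eqP->.
  by exists y; rewrite ?inE.
by exists x; rewrite ?inE 1?adjC // setUC.
Qed.

(** * Degree-preserving switches *)

Definition switch G a b c d : {set {set T}} :=
  [set a; c] |: ([set b; d] |: (G :\ [set a; b] :\ [set c; d])).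

Lemma adj_switch G a b c d x y : adj (switch G a b c d) x y =
  [|| (x == a) && (y == c) || (x == c) && (y == a),
      (x == b) && (y == d) || (x == d) && (y == b) |
      [&& ~~ ((x == c) && (y == d) || (x == d) && (y == c)),
          ~~ ((x == a) && (y == b) || (x == b) && (y == a)) & adj G x y]].
Proof. by rewrite /adj !inE !eq_set2. Qed.

Definition switchable G a b c d : bool :=
  [&& adj G a b, adj G c d, a != c, b != d, ~~ adj G a c & ~~ adj G b d].

(** If a = d or b = c, the edge cd would be the non-edge ac or bd. *)
Lemma switchable_neq G a b c d : switchable G a b c d -> (a != d) && (b != c).
Proof.
case/and5P=> ab cd _ _ /andP[nac nbd]; apply/andP; split.
  by apply: contraNneq nac => ->; rewrite adjC.
by apply: contraNneq nbd => ->.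
Qed.

Lemma switch_simple G a b c d : simple_graph G -> switchable G a b c d ->
  simple_graph (switch G a b c d).
Proof.
move=> /forall_inP sG /and5P[_ _ ac bd _]; apply/forall_inP=> e.
rewrite !inE => /or3P[/eqP-> | /eqP-> | /and3P[_ _ /sG //]].
  by rewrite cards2 ac.
by rewrite cards2 bd.
Qed.

(** The removed pair ab, cd and the inserted pair ac, bd each cover a, b, c, d exactly once. *)
Lemma switch_degree G a b c d : simple_graph G -> switchable G a b c d ->
  degree (switch G a b c d) =1 degree G.
Proof.
move=> sG sw v; have /andP[ad bc] := switchable_neq sw.
rewrite !degree_incident ?switch_simple //.
have /and5P[Gab Gcd ac bd /andP[nac nbd]] := sw.
have [ab cd] := (adj_neq sG Gab, adj_neq sG Gcd).
have Dcd : [set c; d] \in G :\ [set a; b].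
  by rewrite !inE eq_set2 (eq_sym c a) (negPf ac) (eq_sym d a) (negPf ad) andbF.
rewrite [RHS](big_setD1 _ Gab) (big_setD1 _ Dcd) /=.
rewrite /adj in nac nbd.
rewrite /switch !big_setU1 ?inE ?eq_set2 ?(negPf nac) ?(negPf nbd) ?andbF //=.
  rewrite !addnA; congr addn.
  have [-> | _] := eqVneq v a; first by rewrite (negPf ab) (negPf ac) (negPf ad).
  have [-> | _] := eqVneq v b; first by rewrite (negPf bc) (negPf bd).
  by have [-> | _] := eqVneq v c; [rewrite (negPf cd) | case: (v == d)].
by rewrite (negPf ab) (negPf ad).
Qed.

(** * Removing an edge when two vertices are far apart *)

(** Distance at least 4, expressed without paths. *)
Definition far G u w : Prop := forall a b,
  (a == u) || adj G u a -> (b == w) || adj G w b -> (a != b) && ~~ adj G a b.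

Lemma far_sym G u w : far G u w -> far G w u.
Proof. by move=> F a b Ha Hb; have := F b a Hb Ha; rewrite adjC eq_sym. Qed.

Definition rewiring G G' : Prop := simple_graph G' /\ degree G' =1 degree G.

(** When xy is an edge, x is a leaf attached to y. *)
Definition pendant G x y : Prop := forall z, adj G x z -> z = y.

(* The last clause is what makes a further switch possible at a path xyz whose
   ends have no other neighbour. *)
Definition removes G x y G' : Prop :=
  [/\ rewiring G G', ~~ adj G' x y,
      forall z, z != y -> adj G x z -> adj G' x z,
      forall z, z != x -> adj G y z -> adj G' y z
    & pendant G x y \/ pendant G y x ->
      forall z, adj G' x z -> adj G' y z -> False].

Lemma removes_sym G x y G' : removes G x y G' -> removes G y x G'.
Proof.
case=> ? ? ? ? H; split=> // [|? z Hy Hx]; first by rewrite adjC.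
by apply: (H _ z) => //; apply/or_comm.
Qed.

Lemma pendant_common G x y z : simple_graph G -> pendant G x y \/ pendant G y x ->
  adj G x z -> adj G y z -> False.
Proof.
move=> sG [] P xz yz; first by have := adj_neq sG yz; rewrite (P z) ?eqxx.
by have := adj_neq sG xz; rewrite (P z) ?eqxx.
Qed.

(** One switch replaces xy and w'w by xw' and yw. The end y is sent to w, not to w': y may be
    adjacent to w', but adjacency to w would put y in the closed neighbourhood of w, against the
    edge xy. *)
Lemma remove_near G u w w' x y : simple_graph G -> far G u w -> adj G w w' ->
  (x == u) || adj G u x -> adj G x y -> exists G', removes G x y G'.
Proof.
move=> sG F ww' xu xy.
have /andP[xw nxw] : (x != w) && ~~ adj G x w by apply: F => //; rewrite eqxx.
have /andP[xw' nxw'] : (x != w') && ~~ adj G x w' by apply: F => //; rewrite ww' orbT.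
have yw : y != w by apply: contraNneq nxw => <-.
have yw' : y != w' by apply: contraNneq nxw' => <-.
have nyw : ~~ adj G y w.
  apply/negP=> Gyw; have: (x != y) && ~~ adj G x y.
    by apply: F => //; rewrite adjC Gyw orbT.
  by rewrite xy andbF.
have nxy := adj_neq sG xy.
have sw : switchable G x y w' w.
  by rewrite /switchable xy adjC ww' xw' yw nxw' nyw.
exists (switch G x y w' w); split.
- by split; [exact: switch_simple | exact: switch_degree].
- by rewrite adj_switch !eqxx (negPf xw) (negPf xw') (negPf yw) (negPf yw') (negPf nxy).
- move=> z zy xz.
  by rewrite adj_switch xz (negPf xw) (negPf xw') (negPf zy) (negPf nxy) !andbF !orbT.
- move=> z zx yz.
  rewrite adj_switch yz (negPf yw) (negPf yw') (negPf zx) (eq_sym y x) (negPf nxy).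
  by rewrite !andbF !orbT.
(* The new neighbours are w' for x and w for y. The delicate case is z = w' with yw' an old edge: if
   x is the leaf, then y also lies in the closed neighbourhood of u, which [far] forbids. *)
move=> P z; rewrite !adj_switch !eqxx (negPf xw) (negPf xw') (negPf yw) (negPf yw').
rewrite (eq_sym y x) (negPf nxy) /= !orbF.
case/orP=> [/eqP-> | /andP[_ xz]]; case/orP=> [/eqP zw | /andP[_ yz]].
- by have := adj_neq sG ww'; rewrite zw eqxx.
- case: P => [P | /(_ _ yz) w'x]; last by rewrite w'x eqxx in xw'.
  have yu : (y == u) || adj G u y.
    case/orP: xu => [/eqP <- | ux]; first by rewrite xy orbT.
    by rewrite (P u) ?eqxx // adjC.
  by have /andP[_] := F y w' yu (introT orP (or_intror ww')); rewrite yz.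
- by rewrite -zw xz in nxw.
- exact: (pendant_common sG P xz yz).
Qed.

(** Two switches: the first creates the edge uw without touching any edge at x or y; the second
    trades xy and wu for xw and yu, which were non-edges because x and y avoid both closed
    neighbourhoods. *)
Lemma remove_away G u u' w w' x y : simple_graph G -> far G u w ->
  adj G u u' -> adj G w w' ->
  ~~ ((x == u) || adj G u x) -> ~~ ((x == w) || adj G w x) ->
  ~~ ((y == u) || adj G u y) -> ~~ ((y == w) || adj G w y) ->
  adj G x y -> exists G', removes G x y G'.
Proof.
move=> sG F uu' ww' /norP[xu nxu] /norP[xw nxw] /norP[yu nyu] /norP[yw nyw] xy.
have /andP[uw nuw] : (u != w) && ~~ adj G u w by apply: F; rewrite eqxx.
have /andP[uw' nuw'] : (u != w') && ~~ adj G u w' by apply: F; rewrite ?ww' ?eqxx ?orbT.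
have /andP[u'w nu'w] : (u' != w) && ~~ adj G u' w by apply: F; rewrite ?uu' ?eqxx ?orbT.
have /andP[u'w' nu'w'] : (u' != w') && ~~ adj G u' w'.
  by apply: F; rewrite ?ww' ?uu' ?orbT.
have nxy := adj_neq sG xy.
have xu' : x != u' by apply: contraNneq nxu => ->.
have xw' : x != w' by apply: contraNneq nxw => ->.
have yu' : y != u' by apply: contraNneq nyu => ->.
have yw' : y != w' by apply: contraNneq nyw => ->.
have nuu' := adj_neq sG uu'; have nww' := adj_neq sG ww'.
have sw1 : switchable G u u' w w'.
  by rewrite /switchable uu' ww' uw u'w' nuw nu'w'.
pose G1 := switch G u u' w w'.
have sG1 : simple_graph G1 by apply: switch_simple.
have x1 z : adj G1 x z = adj G x z.
  by rewrite adj_switch (negPf xu) (negPf xw) (negPf xu') (negPf xw').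
have y1 z : adj G1 y z = adj G y z.
  by rewrite adj_switch (negPf yu) (negPf yw) (negPf yu') (negPf yw').
have dG1 : degree G1 =1 degree G by apply: switch_degree.
have wu1 : adj G1 w u by rewrite adj_switch !eqxx orbT.
clearbody G1.
have sw2 : switchable G1 x y w u.
  by rewrite /switchable !x1 y1 xy wu1 xw yu (adjC G x) nxw adjC nyu.
exists (switch G1 x y w u); split.
- by split=> [|v]; [exact: switch_simple | rewrite switch_degree].
- by rewrite adj_switch !eqxx (negPf xw) (negPf xu) (negPf yw) (negPf yu) (negPf nxy).
- move=> z zy xz.
  by rewrite adj_switch x1 xz (negPf xw) (negPf xu) (negPf zy) (negPf nxy) !andbF !orbT.
- move=> z zx yz.
  rewrite adj_switch y1 yz (negPf yw) (negPf yu) (negPf zx) (eq_sym y x) (negPf nxy).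
  by rewrite !andbF !orbT.
move=> P z; rewrite !adj_switch x1 y1 !eqxx (negPf xw) (negPf xu) (negPf yw) (negPf yu).
rewrite (eq_sym y x) (negPf nxy) /= !orbF.
case/orP=> [/eqP-> | /andP[_ xz]]; case/orP=> [/eqP zu | /andP[_ yz]].
- by rewrite zu eqxx in uw.
- by rewrite adjC yz in nyw.
- by rewrite adjC -zu xz in nxu.
- exact: (pendant_common sG P xz yz).
Qed.

Lemma remove_edge G u u' w w' x y : simple_graph G -> far G u w ->
  adj G u u' -> adj G w w' -> adj G x y -> exists G', removes G x y G'.
Proof.
move=> sG F uu' ww' xy; have yx : adj G y x by rewrite adjC.
have [xu | xu] := boolP ((x == u) || adj G u x); first exact: remove_near ww' xu xy.
have [xw | xw] := boolP ((x == w) || adj G w x).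
  exact: remove_near (far_sym F) uu' xw xy.
have [yu | yu] := boolP ((y == u) || adj G u y).
  by have [G' /removes_sym] := remove_near sG F ww' yu yx; exists G'.
have [yw | yw] := boolP ((y == w) || adj G w y).
  by have [G' /removes_sym] := remove_near sG (far_sym F) uu' yw yx; exists G'.
exact: remove_away uu' ww' xu xw yu yw xy.
Qed.

(** * Inserting an edge *)

Lemma insert_by_switch G x x' y y' : simple_graph G ->
  adj G x x' -> adj G y y' -> x != y -> x' != y' -> ~~ adj G x' y' ->
  exists G', rewiring G G' /\ adj G' x y.
Proof.
move=> sG xx' yy' nxy nx'y' nx'y'G.
have [Gxy | nGxy] := boolP (adj G x y); first by exists G.
have sw : switchable G x x' y y' by apply/and5P; split=> //; apply/andP.
exists (switch G x x' y y'); split; last by rewrite adj_switch !eqxx.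
by split; [exact: switch_simple | exact: switch_degree].
Qed.

Lemma degree_gt0P G x : reflect (exists y, adj G x y) (0 < degree G x).
Proof.
by apply: (iffP card_gt0P) => -[y]; rewrite ?inE => xy; exists y; rewrite ?inE.
Qed.

Lemma insert_edge G u w x y : simple_graph G -> (forall v, 0 < degree G v) ->
  far G u w -> x != y ->
  exists G', rewiring G G' /\ adj G' x y.
Proof.
move=> sG dG F nxy.
have nb v : exists v', adj G v v' by apply/degree_gt0P.
have [[u' uu'] [w' ww']] := (nb u, nb w).
have [Gxy | nGxy] := boolP (adj G x y); first by exists G.
have [/existsP[x' /existsP[y' /and3P[xx' yy' nx'y']]] | no_pair] :=
  boolP [exists x', exists y', [&& adj G x x', adj G y y' & x' != y']].
  have [x'y' | nx'y'G] := boolP (adj G x' y'); last exact: insert_by_switch nx'y'G.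
  have [G' [[sG' dG'] nG' x'G' y'G' _]] := remove_edge sG F uu' ww' x'y'.
  (* The edges xx' and yy' survive the removal of x'y', since x = y' or y = x' would make xy an
     edge. *)
  have [||||||G2 [[sG2 dG2] xyG2]] := @insert_by_switch G' x x' y y' => //.
  - by rewrite adjC x'G' 1?adjC //; apply: contraNneq nGxy => ->; rewrite adjC.
  - by rewrite adjC y'G' 1?adjC //; apply: contraNneq nGxy => ->.
  by exists G2; split=> //; split=> // v; rewrite dG2 dG'.
(* In the remaining case x and y are leaves attached to the same vertex, called z below. *)
have common x' y' : adj G x x' -> adj G y y' -> x' = y'.
  move=> xx' yy'; apply: contraNeq no_pair => nx'y'.
  by apply/existsP; exists x'; apply/existsP; exists y'; rewrite xx' yy'.
have [[x' xx'] [z yz]] := (nb x, nb y).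
have xz : adj G x z by rewrite -(common _ _ xx' yz).
have [G' [[sG' dG'] nG' _ zG' cG']] := remove_edge sG F uu' ww' xz.
(* Having lost z, x must have gained a neighbour x''. By the last clause of [removes], x'' is not
   adjacent to z, so xx'' and yz can be switched to xy and x''z. *)
have /degree_gt0P[x'' xx''] : 0 < degree G' x by rewrite dG'.
have [||||||G2 [[sG2 dG2] xyG2]] := @insert_by_switch G' x x'' y z => //.
- by rewrite adjC zG' 1?adjC // eq_sym.
- by apply: contraNneq nG' => <-.
- apply/negP=> x''z; apply: (cG' _ x'') => //; last by rewrite adjC.
  by left=> t xt; exact: common xt yz.
by exists G2; split=> //; split=> // v; rewrite dG2 dG'.
Qed.

(** * From far vertices to the diameter *)

(** A violation of [far] gives a walk of length at most 3 from u to w. Since [joined_by_path] wants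
    distinct vertices, lengths 0 and 1 are excluded first; this yields the distinctness needed for
    lengths 2 and 3. *)
Lemma path_far G u w : simple_graph G ->
  (forall k, k <= 3 -> ~~ joined_by_path G u w k) -> far G u w.
Proof.
move=> sG nj.
have noP (p : seq T) : size p <= 3 -> path (adj G) u p -> uniq (u :: p) ->
    last u p = w -> False.
  move=> sz Pp Up Lp; case/existsP: (nj _ sz); exists (in_tuple p).
  by rewrite Pp Up Lp eqxx.
have uw : u != w by apply/eqP=> E; apply: (noP [::]).
have nuw : ~~ adj G u w.
  by apply/negP=> H; apply: (noP [:: w]); rewrite //= ?H ?inE ?uw.
have two v : adj G u v -> adj G w v -> False.
  move=> uv wv; apply: (noP [:: v; w]); rewrite //= ?uv 1?adjC ?wv //.
  by rewrite !inE negb_or uw (adj_neq sG uv) eq_sym (adj_neq sG wv).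
have three a b : adj G u a -> adj G w b -> adj G a b -> False.
  move=> ua wb ab; apply: (noP [:: a; b; w]); rewrite //= ?ua ?ab 1?adjC ?wb //.
  rewrite !inE !negb_or uw (adj_neq sG ua) (adj_neq sG ab) (eq_sym b) (adj_neq sG wb).
  rewrite !andbT; apply/andP; split.
    by apply: contraNneq nuw => ->; rewrite adjC.
  by apply: contraNneq nuw => <-.
move=> a b /orP[/eqP-> | ua] /orP[/eqP-> | wb].
- by rewrite uw nuw.
- apply/andP; split; last by apply/negP=> ub; apply: (two b).
  by apply: contraNneq nuw => ->; rewrite adjC.
- apply/andP; split; last by rewrite adjC; apply/negP=> wa; apply: (two a).
  by apply: contraNneq nuw => <-.
apply/andP; split; last by apply/negP; apply: three.
by apply/eqP=> ab; apply: (two a) => //; rewrite ab.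
Qed.

Lemma dist_le G x y k : joined_by_path G x y k ->
  exists2 d : nat, dist G x y = Some d & d <= k.
Proof.
move=> jk; have kT : k < #|T|.
  case/existsP: jk => p /and3P[_ Up _].
  by have := max_card (mem (x :: p)); rewrite (card_uniqP Up) /= size_tuple.
have le_find : find (joined_by_path G x y) (iota 0 #|T|) <= k.
  rewrite leqNgt; apply/negP=> /(before_find 0).
  by rewrite nth_iota // jk.
by rewrite /dist (leq_ltn_trans le_find kT); exists (find (joined_by_path G x y) (iota 0 #|T|)).
Qed.

Lemma diam_le3 G : simple_graph G -> (forall u w, ~ far G u w) ->
  exists d : nat, diam G = Some d /\ d <= 3.
Proof.
move=> sG nF.
have dist3 x y : exists2 d : nat, dist G x y = Some d & d <= 3.
  have [/existsP[k] | no_k] := boolP [exists k : 'I_4, joined_by_path G x y k].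
    by case/dist_le=> d Dd dk; exists d; rewrite // (leq_trans dk) // -ltnS.
  case: (nF x y); apply: path_far => // k k3.
  by apply: contra no_k => jk; apply/existsP; exists (Ordinal (k3 : k < 4)).
rewrite /diam ifT; last first.
  by apply/forallP=> x; apply/forallP=> y; case: (dist3 x y) => d ->.
(* The witness is the double maximum in [diam], bounded term by term. *)
eexists; split; first reflexivity.
apply/bigmax_leqP=> x _; apply/bigmax_leqP=> y _.
by case: (dist3 x y) => d ->.
Qed.

End Switch.

(** * Forced and forbidden edges of a degree sequence *)

Lemma last_leq_degree_sequence n (alpha : n.-tuple nat) (i : 'I_n) :
  degree_sequence alpha -> last 0 alpha <= tnth alpha i.
Proof.
case/andP=> _ sa; rewrite -nth_last size_tuple (tnth_nth 0).
have geq_trans : transitive geq by move=> a b c ba cb; exact: leq_trans cb ba.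
(* The index i shows that n is positive, so [n.-1] is a valid index and the last entry is a genuine
   one. *)
have n0 := leq_ltn_trans (leq0n i) (ltn_ord i).
apply: (sorted_leq_nth geq_trans leqnn) => //.
- by rewrite inE size_tuple.
- by rewrite inE size_tuple prednK.
- by rewrite -ltnS prednK.
Qed.

Theorem theorem15 (n : nat) (alpha : n.-tuple nat)
    (halpha : degree_sequence alpha)
    (hgraphic : graphic alpha)
    (hmin : 1 <= last 0 alpha)
    (hFB : forced alpha != set0 \/ forbidden alpha != set0) :
  forall G : {set {set 'I_n}}, realization alpha G ->
    exists d : nat, diam G = Some d /\ d <= 3.
Proof.
move=> G /andP[sG /forallP dG]; apply: diam_le3 => // u w F.
have degG v : 0 < degree G v.
  by rewrite (eqP (dG v)) (leq_trans hmin) // last_leq_degree_sequence.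
have real G' : simple_graph G' -> degree G' =1 degree G -> realization alpha G'.
  by move=> sG' dG'; rewrite /realization sG'; apply/forallP=> i; rewrite dG'.
(* A forced edge lies in G itself, so it can be removed; a forbidden pair can be inserted. Either
   result is a realization contradicting the choice of e. *)
case: hFB => /set0Pn[e]; rewrite inE => /andP[/cards2P[x [y [xy ->]]] /forall_inP all_e].
  have [/degree_gt0P[u' uu'] /degree_gt0P[w' ww']] := (degG u, degG w).
  have xyG : adj G x y by apply: all_e; apply: real.
  have [G' [[sG' dG'] nG' _ _ _]] := remove_edge sG F uu' ww' xyG.
  by case/negP: nG'; apply: all_e; apply: real.
have [G' [[sG' dG'] xyG']] := insert_edge sG degG F xy.
by case/negP: (all_e G' (real _ sG' dG')).
Qed.
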